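(* Let $p\in(0,1)$. Let $\mathcal M$ be a complete market given by an atomless probability space $(\Omega,\mathcal F,\mathbb P)$ equipped with a probability measure $\mathbb Q$ equivalent to $\mathbb P$, in which any $X\in L^\infty(\Omega;\mathbb R)$ can be purchased at the price $$\mathcal P(X)=e^{-rT}\,\mathbb E_{\mathbb Q}(X),$$ where $T$ is the time horizon of the investment and $r\in\mathbb R$ is the risk-free rate. Then this market admits an $\mathrm{ES}_p$-arbitrage if and only if $$\mathbb P\left(\frac{d\mathbb Q}{d\mathbb P}\ge\frac1p\right)>0.$$
   Context: A market consists of a probability space $(\Omega,\mathcal F,\mathbb P)$ and a pricing function $\mathcal P:L^0(\Omega,\mathbb R)\to\mathbb R\cup\{+\infty\}$; assets with price $+\infty$ cannot be purchased. Here the purchasable assets are the elements of $L^\infty(\Omega;\mathbb R)$, i.e. $\mathcal P(X)=+\infty$ for $X\notin L^\infty(\Omega;\mathbb R)$. For a random variable $X$ with cumulative distribution function $F_X$ (under $\mathbb P$), $\mathrm{VaR}_q(X)=-\inf\{x\in\mathbb R: F_X(x)>q\}$ and expected shortfall at confidence level $p$ is $\mathrm{ES}_p(X)=\frac1p\int_0^p \mathrm{VaR}_q(X)\,dq$. An $\mathrm{ES}_p$-arbitrage is a random variable $X$ with $\mathcal P(X)\le 0$, $\mathrm{ES}_p(X)\le 0$ and $\mathbb P(X>0)>0$. *)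

(* Defs.v *)
From HB Require Import structures.
From mathcomp Require Import all_boot all_order all_algebra.
From mathcomp Require Import all_classical all_reals all_analysis ess_sup_inf.

Set Implicit Arguments.
Unset Strict Implicit.
Unset Printing Implicit Defensive.
Import Order.TTheory GRing.Theory Num.Theory.
Import numFieldNormedType.Exports.

Local Open Scope classical_set_scope.
Local Open Scope ring_scope.
Local Open Scope ereal_scope.

Section defs.
Context d (T : measurableType d) (R : realType).
Implicit Types P Q : probability T R.

Definition atomless P := forall A, measurable A -> 0 < P A ->
  exists B, [/\ measurable B, B `<=` A & 0 < P B < P A].

Definition equivalent_measures P Q := P `<< Q /\ Q `<< P.

(* Random variables up to P-almost sure equality. *)
Definition L0 P : Type := {mfun_ P, T >-> R}.

(* The canonical representative of a class. All notions below are invariant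
   under P-almost sure equality, so they do not depend on this choice. *)
Definition L0_RV P (X : L0 P) : {RV P >-> R} := repr X.

Definition Linfty P (X : L0 P) : bool := (L0_RV X : T -> R) \in Lfun P +oo.

(* The infimum is taken in the extended reals; it is finite for 0 < q < 1. *)
Definition VaR P (q : R) (X : {RV P >-> R}) : \bar R :=
  - ereal_inf [set x%:E | x in [set x : R | q%:E < cdf X x]].

Definition ES P (p : R) (X : {RV P >-> R}) : \bar R :=
  (p^-1)%:E * \int[lebesgue_measure]_(q in `[0%R, p]) VaR q X.

(* Prices live in R together with +oo, the price of what cannot be bought. *)
Record market P := Market {
  price : L0 P -> \bar R;
  price_neqNy : forall X, price X != -oo }.

Definition ES_arbitrage P (M : market P) (p : R) (X : L0 P) : Prop :=
  [/\ price M X <= 0, ES p (L0_RV X) <= 0 & 0 < P [set w | (0 < L0_RV X w)%R]].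

Definition admits_ES_arbitrage P (M : market P) (p : R) : Prop :=
  exists X : L0 P, ES_arbitrage M p X.

Section complete_market.
Variables (P Q : probability T R) (PQ : equivalent_measures P Q) (r t : R).

Definition complete_price (X : L0 P) : \bar R :=
  if Linfty X then (expR (- (r * t)))%:E * 'E_Q[L0_RV X] else +oo.

Lemma complete_price_neqNy X : complete_price X != -oo.
Proof.
rewrite /complete_price; case: ifPn => // XL.
suff Efin : 'E_Q[L0_RV X] \is a fin_num.
  by have := fin_numM (isT : (expR (- (r * t)))%:E \is a fin_num) Efin;
    rewrite fin_numE => /andP[].
apply/expectation_fin_num/(@Lfun_subset _ _ _ Q 1 +oo) => //; rewrite ?leey//.
  exact: fin_num_measure.
move: XL; rewrite /Linfty inE => /andP[XM XL]; rewrite inE; apply/andP; split=> //.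
move: XL; rewrite !inE /= /finite_norm unlock.
have pos (S : probability T R) : 0 < S setT by rewrite probability_setT.
rewrite !pos.
apply: le_lt_trans; apply/ess_supP.
have [N [mN N0 PN]] := ess_sup_ge P (abse \o (EFin \o L0_RV X)).
exists N; split=> //; have [_ /null_content_dominatesP QP] := PQ.
exact: QP.
Qed.

Definition complete_market : market P := Market complete_price_neqNy.

End complete_market.
End defs.

(* Main.v *)
Require Import Defs.
From HB Require Import structures.
From mathcomp Require Import all_boot all_order all_algebra.
From mathcomp Require Import all_classical all_reals all_analysis.
From mathcomp Require Import measurable_realfun ess_sup_inf.
From mathcomp Require Import lra.

(** Let f = dQ/dP. If A = {f >= 1/p} has positive probability, then
    P(A) <= p Q(A) <= p, and X = 1 - (p / P(A)) 1_A is an arbitrage: its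
    p-quantile is 1, so ES_p(X) = E_P[(1 - X)^+] / p - 1 = 0, while
    E_Q[X] = 1 - p Q(A) / P(A) <= 0 and X = 1 off A.

    Conversely let f < 1/p a.s. and let c be the p-quantile of X. From
    ES_p(X) = E_P[(c - X)^+] / p - c <= 0 we get
      E_Q[X] = c - E_P[f (c - X)^+] + E_Q[(X - c)^+]
             >= E_P[(1/p - f) (c - X)^+] + E_Q[(X - c)^+] >= 0,
    and E_Q[X] <= 0 forces both terms to vanish, hence X = c = 0 a.s. *)

Set Implicit Arguments.
Unset Strict Implicit.
Unset Printing Implicit Defensive.
Import Order.TTheory GRing.Theory Num.Theory.
Import numFieldNormedType.Exports.

Local Open Scope classical_set_scope.
Local Open Scope charge_scope.
Local Open Scope ring_scope.
Local Open Scope ereal_scope.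

(** * Upper quantiles and lower tails *)

Section quantile.
Context d (T : measurableType d) (R : realType) (P : probability T R).
Variable X : {RV P >-> R}.

(** By continuity from below, the mass of []-oo, x[] is the supremum of the cdf over points less
    than [x]; it exceeds [q] exactly when the cdf does at some such point. *)
Lemma ereal_inf_cdf_lt (q x : R) :
  ereal_inf [set y%:E | y in [set y : R | q%:E < cdf X y]] < x%:E <->
  q%:E < distribution P X `]-oo, x[.
Proof.
split=> [/ereal_inf_lt[_ [y /= qy <-]]|qx].
  rewrite lte_fin => yx; apply: (lt_le_trans qy).
  by apply: le_measure; rewrite ?inE//; apply: subset_itvl; rewrite bnd_simp.
suff [n qn] : exists n : nat, q%:E < cdf X (x - n.+1%:R^-1).
  apply: (@le_lt_trans _ _ (x - n.+1%:R^-1)%:E).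
    by apply: ereal_inf_lbound; exists (x - n.+1%:R^-1)%R.
  by rewrite lte_fin ltrBlDr ltrDl invr_gt0.
apply: contrapT => /forallNP qF; move: qx; apply/negP; rewrite -leNgt.
pose F n := `]-oo, (x - n.+1%:R^-1)%R]%classic.
have mF : measurable (\bigcup_n F n).
  by apply: bigcup_measurable => n _; exact: measurable_itv.
apply: (@le_trans _ _ (distribution P X (\bigcup_n F n))).
  apply: le_measure; rewrite ?inE// => y /=; rewrite in_itv/= => yx.
  have [n nyx] := ltr_add_invr yx.
  by exists n => //; rewrite /F/= in_itv/= lerBrDr ltW.
apply: (@cvge_le _ _ eventually_filter _ (distribution P X \o F)); last first.
- apply: nondecreasing_cvg_mu => [n|//|m n mn]; first exact: measurable_itv.
  apply/subsetPset/subset_itvl; rewrite bnd_simp.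
  by rewrite lerD2l lerN2 lef_pV2 ?posrE// ler_nat.
- by apply: nearW => n; rewrite leNgt; apply/negP/qF.
Qed.

(** The limits 0 and 1 of the cdf lie strictly on either side of [q], so the set under the infimum
    is bounded below and nonempty. *)
Lemma VaR_fin_num (q : R) : (0 < q < 1)%R -> VaR q X \is a fin_num.
Proof.
move=> /andP[q0 q1]; rewrite /VaR fin_numN fin_numE; apply/andP; split.
  have /filter_ex[x qx] : \forall x \near -oo%R, cdf X x < q%:E.
    by apply/(@cvg_cdfNy0 _ _ _ P X [set y | y < q%:E])/open_ereal_lt'.
  rewrite gt_eqF// (@lt_le_trans _ _ x%:E) ?ltNyr//.
  apply: le_ereal_inf_tmp => _ [y /= qy <-].
  rewrite lee_fin leNgt; apply/negP => yx.
  have := lt_trans qx qy; apply/negP; rewrite -leNgt.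
  exact/cdf_nondecreasing/ltW.
have /filter_ex[x qx] : \forall x \near +oo%R, q%:E < cdf X x.
  by apply/(@cvg_cdfy1 _ _ _ P X [set y | q%:E < y])/open_ereal_gt'.
rewrite lt_eqF// (@le_lt_trans _ _ x%:E) ?ltry//.
by apply: ereal_inf_lbound; exists x.
Qed.

Lemma quantile_ltP (q x : R) : (0 < q < 1)%R ->
  (- fine (VaR q X) < x)%R <-> q%:E < distribution P X `]-oo, x[.
Proof.
move=> q01; rewrite -ereal_inf_cdf_lt -lte_fin EFinN fineK ?VaR_fin_num//.
by rewrite /VaR oppeK.
Qed.

(** For [q = p] this keeps the tails of the shortfall inside the range [[0, p]] of the uniform
    law. *)
Lemma distribution_lt_quantile (q t : R) : (0 < q < 1)%R -> (0 <= t)%R ->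
  distribution P X `]-oo, (- fine (VaR q X) - t)%R[ <= q%:E.
Proof.
move=> q01 t0; rewrite leNgt; apply/negP => /(quantile_ltP _ q01).
by rewrite ltrDl oppr_gt0 ltNge t0.
Qed.

End quantile.

(** * Expected shortfall as a mean shortfall below the quantile *)

Lemma uniform_prob_itvoo (R : realType) (p s : R) (p0 : (0 < p)%R) :
  (0 <= s <= p)%R -> uniform_prob p0 `]0%R, s[ = (p^-1 * s)%:E.
Proof.
move=> /andP[s0 sp]; rewrite /uniform_prob.
rewrite (eq_integral (fun=> p^-1%:E)); last first.
  move=> x; rewrite inE/= in_itv/= => /andP[x0 xs].
  by rewrite /uniform_pdf ltW//= (ltW (lt_le_trans xs sp)) subr0.
rewrite integral_cst//= lebesgue_measure_itv/= lte_fin.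
have [->|sN0] := eqVneq s 0%R; first by rewrite ltxx mulr0 mule0.
by rewrite lt_neqAle eq_sym sN0 s0/= sube0 EFinM.
Qed.

Section ES.
Context d (T : measurableType d) (R : realType) (P : probability T R).
Variables (X : {RV P >-> R}) (p : R).
Hypothesis p01 : (0 < p < 1)%R.
Let c := (- fine (VaR p X))%R.
Let p0 : (0 < p)%R. Proof. by case/andP: p01. Qed.

(** The gap between the [p]-quantile and the [q]-quantile. The value 0 outside []0, p]] avoids
    [q = 0], where [VaR] may be infinite. *)
Let Y (q : measurableTypeR R) : R :=
  if (0 < q <= p)%R then (c + fine (VaR q X))%R else 0%R.

(** For [q] in []0, p]], [t < Y q] says that the [q]-quantile is less than [c - t], which
    [quantile_ltP] turns into a bound on [q]. This gives both the measurability and the law of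
    [Y]. *)
Let Y_gt (t : R) : (0 <= t)%R ->
  [set q | (t < Y q)%R] =
  `]0%R, fine (distribution P X `]-oo, (c - t)%R[)[%classic.
Proof.
move=> t0; set s := distribution _ _ _.
have sfin : s \is a fin_num by exact: fin_num_measure.
have sp : s <= p%:E by exact: distribution_lt_quantile.
apply/seteqP; split=> q /=; rewrite /Y in_itv/=.
  case: ifPn => [/andP[q0 qp]|_]; last by rewrite ltNge t0.
  move=> tq; rewrite q0 -lte_fin fineK//; apply/quantile_ltP; last first.
    by rewrite ltrBrDr -ltrBrDl opprK.
  by rewrite q0 (le_lt_trans qp)//; case/andP: p01.
move=> /andP[q0]; rewrite -lte_fin fineK// => qs.
have qp : (q < p)%R by rewrite -lte_fin (lt_le_trans qs).
rewrite q0 ltW//=; move/quantile_ltP : qs.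
rewrite q0 (lt_trans qp)/=; last by case/andP: p01.
by move=> /(_ isT); rewrite ltrBrDr -ltrBrDl opprK.
Qed.

Let Y_ge0 q : (0 <= Y q)%R.
Proof.
rewrite /Y; case: ifPn => // /andP[q0 qp].
have q01 : (0 < q < 1)%R by rewrite q0 (le_lt_trans qp)//; case/andP: p01.
rewrite -lerBlDr sub0r leNgt; apply/negP => /(quantile_ltP X _ p01) pq.
have /(quantile_ltP X _ q01) := @le_lt_trans _ _ p%:E q%:E _ qp pq.
by rewrite ltxx.
Qed.

Let mY : measurable_fun setT Y.
Proof.
apply: (measurability _ (RGenOInfty.measurableE R)) => // _ [_ [t ->] <-].
rewrite setTI.
have [t0|t0] := leP 0%R t.
  rewrite [X in measurable X](_ : _ = [set q | (t < Y q)%R]); last first.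
    by apply/seteqP; split=> q; rewrite /= in_itv/= andbT.
  by rewrite Y_gt.
rewrite [X in measurable X](_ : _ = setT)//; apply/seteqP; split=> q //= _.
by rewrite in_itv/= andbT (lt_le_trans t0).
Qed.

HB.instance Definition _ := isMeasurableFun.Build _ _ _ _ _ mY.

Let Z : T -> R := (cst c \- X)^\+%R.

Let mZ : measurable_fun [set: T] Z.
Proof. by apply: measurable_funrpos => //; exact: measurable_funB. Qed.

HB.instance Definition _ := isMeasurableFun.Build _ _ _ _ _ mZ.

(* Both expectations are integrals of tails: by [Y_gt], under the uniform law on
   [0, p] the tail of Y at t is p^-1 * P(X < c - t). *)
Let expectation_Y :
  (p^-1)%:E * \int[lebesgue_measure]_(q in `[0%R, p]) (Y q)%:E =
  (p^-1)%:E * 'E_P[Z].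
Proof.
transitivity ('E_(uniform_prob p0)[Y]).
  by rewrite unlock integral_uniform ?subr0//=; exact/measurable_EFinP.
rewrite (@ge0_expectation_ccdf _ _ _ (uniform_prob p0) Y)//.
rewrite (@ge0_expectation_ccdf _ _ _ P Z); last exact: funrpos_ge0.
rewrite -ge0_integralZl//; last 2 first.
- by apply: measurable_funTS; exact: ccdf_measurable.
- by rewrite lee_fin invr_ge0 ltW.
apply: eq_integral => t; rewrite inE/= in_itv/= andbT => t0.
set s := distribution P X `]-oo, (c - t)%R[.
have sfin : s \is a fin_num by exact: fin_num_measure.
have sp : s <= p%:E by exact: distribution_lt_quantile.
transitivity (uniform_prob p0 `]0%R, fine s[).
  rewrite -Y_gt// /ccdf; congr (uniform_prob _ _).
  by apply/seteqP; split=> q; rewrite /= in_itv/= andbT.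
have s0p : (0 <= fine s <= p)%R.
  by apply/andP; split; [exact/fine_ge0/measure_ge0|rewrite -lee_fin fineK].
rewrite uniform_prob_itvoo// EFinM fineK//.
congr (_ * P _); apply/seteqP; split=> w /=.
  by rewrite !in_itv/= andbT => Xw; rewrite lt_max ltrBrDr -ltrBrDl Xw.
rewrite !in_itv/= andbT lt_max [X in _ || X]ltNge t0 orbF.
by rewrite ltrBrDr -ltrBrDl.
Qed.

(** On []0, p]], [VaR q X] equals [Y q - c], and [expectation_Y] evaluates the average of [Y].
    Integrability of [X] makes that average finite, so that the integral splits. *)
Lemma ES_VaR_shortfall : P.-integrable setT (EFin \o X) ->
  ES p X = (p^-1)%:E * 'E_P[(cst c \- X)^\+%R] - c%:E.
Proof.
move=> iX.
have mYp (D : set (measurableTypeR R)) :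
    measurable_fun D (EFin \o (Y : measurableTypeR R -> R)).
  by apply/measurable_funTS/measurable_EFinP.
have iZ : P.-integrable setT (EFin \o Z).
  apply: integrable_funrpos => //.
  rewrite [X in _.-integrable _ X](_ : _ = (EFin \o cst c) \- (EFin \o X))//.
  by apply: integrableB => //; exact: finite_measure_integrable_cst.
have EZ : 'E_P[Z] \is a fin_num by apply/expectation_fin_num/Lfun1_integrable.
have VaRE q : q \in `]0%R, p]%classic -> VaR q X = (Y q)%:E - c%:E.
  rewrite inE/= in_itv/= => q0p; rewrite /Y q0p EFinD addeAC subee// add0e.
  rewrite fineK// VaR_fin_num//; case/andP: q0p => q0 qp.
  by rewrite q0 (le_lt_trans qp)//; case/andP: p01.
have Yge0 : 0 <= \int[lebesgue_measure]_(q in `[0%R, p]) (Y q)%:E.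
  by apply: integral_ge0 => q _; rewrite lee_fin.
have Yfin : \int[lebesgue_measure]_(q in `[0%R, p]) (Y q)%:E \is a fin_num.
  have := fin_numM (isT : (p^-1)%:E \is a fin_num) EZ.
  rewrite -expectation_Y => pYfin.
  rewrite ge0_fin_numE// ltey; apply: contraTneq pYfin => ->.
  by rewrite gt0_muley// lte_fin invr_gt0.
(* The endpoint 0 is dropped from the integral, since [VaR] and [Y - c] may differ there. *)
rewrite -expectation_Y /ES -integral_itv_obnd_cbnd; last first.
  apply: (eq_measurable_fun (fun q => (Y q)%:E - c%:E)).
    by move=> q q0p; rewrite VaRE.
  exact: emeasurable_funB.
rewrite (eq_integral (fun q => (Y q)%:E - c%:E))//.
rewrite integralB//; last 2 first.
- apply/integrableP; split=> //.
  under eq_integral do rewrite gee0_abs ?lee_fin//.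
  rewrite integral_itv_obnd_cbnd; last exact: mYp.
  by move: Yfin; rewrite ge0_fin_numE.
- apply/integrableP; split=> //.
  rewrite integral_cst//= lebesgue_measure_itv/= lte_fin p0 sube0.
  exact: ltry.
rewrite integral_itv_obnd_cbnd; last exact: mYp.
rewrite integral_cst//= lebesgue_measure_itv/= lte_fin p0 sube0.
rewrite muleBr//; last first.
  by rewrite fin_num_adde_defl// fin_numN.
by rewrite -!EFinM mulrCA mulVf ?mulr1// gt_eqF.
Qed.

End ES.

(** * Essentially bounded variables and almost sure equality *)

Section bounded.
Context d (T : measurableType d) (R : realType).
Implicit Types P Q : probability T R.

Lemma Lfun_inftyP P (X : {RV P >-> R}) :
  (X : T -> R) \in Lfun P +oo <-> exists M, \forall w \ae P, (`|X w| <= M)%R.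
Proof.
have P0 : 0 < P setT by rewrite probability_setT.
rewrite inE; split=> [/andP[_]|[M XM]].
  rewrite !inE /= /finite_norm unlock P0 => Xoo.
  (* An essential supremum [-oo] would put [|X|] below [-oo] almost surely, so any real bound
     follows vacuously. *)
  have [E|EN] := eqVneq (ess_sup P (abse \o (EFin \o X))) -oo.
    exists 0%R; have := ess_sup_ge P (abse \o (EFin \o X)).
    by apply: filterS => w /=; rewrite E leeNy_eq.
  exists (fine (ess_sup P (abse \o (EFin \o X)))).
  have := ess_sup_ge P (abse \o (EFin \o X)).
  apply: filterS => w /= Xw; rewrite -lee_fin fineK//.
  by rewrite fin_numE EN/= lt_eqF.
apply/andP; split; first exact: mfunP.
rewrite !inE/= /finite_norm unlock P0.
by apply: le_lt_trans (ltry M); apply/ess_supP.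
Qed.

Lemma Lfun_infty_dominates P Q (X : {RV P >-> R}) : Q `<< P ->
  (X : T -> R) \in Lfun P +oo -> (X : T -> R) \in Lfun Q +oo.
Proof.
move=> /null_content_dominatesP QP /Lfun_inftyP[M [N [mN N0 XN]]].
by apply/(Lfun_inftyP (X : {RV Q >-> R})); exists M, N; split=> //; exact: QP.
Qed.

Lemma Lfun_infty_integrable P (X : {RV P >-> R}) :
  (X : T -> R) \in Lfun P +oo -> P.-integrable setT (EFin \o X).
Proof.
move=> Xoo; apply/Lfun1_integrable/(@Lfun_subset _ _ _ P 1 +oo) => //.
- exact: leey.
- exact: fin_num_measure.
- exact: leey.
Qed.

(** Probabilities are written as integrals of indicators, which ignore null sets. This frees laws
    from the choice of representative in [L0]. *)
Lemma ae_eq_distribution P (X Y : {RV P >-> R}) (B : set R) : measurable B ->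
  X = Y %[ae P] -> distribution P X B = distribution P Y B.
Proof.
move=> mB XY; rewrite /distribution /pushforward.
rewrite -(setIT (X @^-1` B)) -(setIT (Y @^-1` B)).
rewrite -!integral_indic//; do ?exact: measurable_funPTI.
apply: ae_eq_integral => //;
  do ?exact/measurable_EFinP/measurable_indic/measurable_funPTI.
apply: filterS XY => w /(_ I) XYw _; rewrite !indicE.
congr ((nat_of_bool _)%:R%:E).
by apply/idP/idP; rewrite !inE/= XYw.
Qed.

End bounded.

(** * No arbitrage under a density below [1/p] *)

Section no_arbitrage.
Context d (T : measurableType d) (R : realType) (P Q : probability T R).
Hypothesis PQ : equivalent_measures P Q.
Variables (p : R) (X : {RV P >-> R}).
Hypotheses (p01 : (0 < p < 1)%R) (Xoo : (X : T -> R) \in Lfun P +oo).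

Lemma ae_eq0_of_density_lt :
  (\forall w \ae P, ('d (charge_of_finite_measure Q) '/d P) w < (p^-1)%:E) ->
  'E_Q[X] <= 0 -> ES p X <= 0 -> \forall w \ae P, X w = 0%R.
Proof.
have [PQ' QP] := PQ => fp EQ0 ES0.
have p0 : (0 < p)%R by case/andP: p01.
have pV0 : (0 < p^-1)%R by rewrite invr_gt0.
(* A version of the density that is nonnegative and finite everywhere, so that products and
   differences with it need no exceptional set. *)
pose g := Radon_Nikodym_SigmaFinite.f Q P.
have g0 w : 0 <= g w by exact: Radon_Nikodym_SigmaFinite.f_ge0.
have gfin w : g w \is a fin_num by exact: Radon_Nikodym_SigmaFinite.f_fin_num.
have mg : measurable_fun setT g.
  exact: measurable_int (Radon_Nikodym_SigmaFinite.f_integrable QP).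
have gp : \forall w \ae P, g w < (p^-1)%:E.
  have := ae_eq_Radon_Nikodym_SigmaFinite QP measurableT.
  by apply: filterS2 fp => w fw /(_ I) /= gw; rewrite /g gw.
pose c := (- fine (VaR p X))%R.
pose U := (cst c \- X)^\+%R; pose V := (cst c \- X)^\-%R.
have iX (S : probability T R) : (X : T -> R) \in Lfun S +oo ->
    S.-integrable setT (EFin \o (cst c \- X)%R).
  move=> XS.
  rewrite [X in _.-integrable _ X](_ : _ = (EFin \o cst c) \- (EFin \o X))//.
  apply: integrableB => //; first exact: finite_measure_integrable_cst.
  exact: (@Lfun_infty_integrable _ _ _ S X).
have XQ := @Lfun_infty_dominates _ _ _ P Q X QP Xoo.
have iUP : P.-integrable setT (EFin \o U) by apply/integrable_funrpos/iX.
have iUQ : Q.-integrable setT (EFin \o U) by apply/integrable_funrpos/iX.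
have iVQ : Q.-integrable setT (EFin \o V) by apply/integrable_funrneg/iX.
have U0 w : 0 <= (U w)%:E by rewrite lee_fin funrpos_ge0.
have V0 w : 0 <= (V w)%:E by rewrite lee_fin funrneg_ge0.
have EU : \int[P]_w ((U w)%:E * g w) = \int[Q]_w (U w)%:E.
  apply: Radon_Nikodym_SigmaFinite.change_of_variables => //.
  exact: measurable_int iUQ.
have iUg : P.-integrable setT (fun w => (U w)%:E * g w).
  exact: (Radon_Nikodym_SigmaFinite.integrableM QP U0 _ iUQ).
have EQE : 'E_Q[X] = c%:E - \int[Q]_w (U w)%:E + \int[Q]_w (V w)%:E.
  rewrite (_ : (X : T -> R) = (cst c \- U \+ V)%R); last first.
    apply/funext => w; have := congr1 (@^~ w) (funrposBneg (cst c \- X)%R).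
    by rewrite -/U -/V !fctE /= => UV; lra.
  rewrite expectationD ?expectationB ?expectation_cst; last 4 first.
  - exact: Lfun_cst.
  - exact/Lfun1_integrable.
  - apply/Lfun1_integrable.
    rewrite [X in _.-integrable _ X](_ : _ = (EFin \o cst c) \- (EFin \o U))//.
    by apply: integrableB => //; exact: finite_measure_integrable_cst.
  - exact/Lfun1_integrable.
  by rewrite unlock.
have ESle : (p^-1)%:E * \int[P]_w (U w)%:E <= c%:E.
  move: ES0; rewrite ES_VaR_shortfall//; last exact: Lfun_infty_integrable.
  by rewrite unlock sube_le0.
(* In the formula for the price, [c] is replaced by its lower bound [ESle]. *)
have UV : \int[Q]_w (V w)%:E +
    ((p^-1)%:E * \int[P]_w (U w)%:E - \int[Q]_w (U w)%:E) <= 0.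
  by apply: le_trans EQ0; rewrite EQE addeC leeD2r// leeB//.
have mW : measurable_fun setT (fun w => (p^-1)%:E * (U w)%:E - (U w)%:E * g w).
  apply: emeasurable_funB; last exact: measurable_int iUg.
  by apply: emeasurable_funM => //; exact: measurable_int iUP.
(* Since [g < 1/p] almost surely, the absolute value changes nothing almost everywhere; it is there
   for the criterion by which a zero integral forces a null integrand. *)
have W0 : \int[P]_w `|(p^-1)%:E * (U w)%:E - (U w)%:E * g w| =
    (p^-1)%:E * \int[P]_w (U w)%:E - \int[Q]_w (U w)%:E.
  rewrite -EU -integralZl// -integralB//; last exact: integrableZl.
  apply: ae_eq_integral => //; first exact: measurableT_comp.
  apply: filterS gp => w gp _; rewrite gee0_abs// muleC -muleBr//.
  by rewrite mule_ge0// sube_ge0 ?ltW ?gfin.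
have W_ge0 : 0 <= \int[P]_w `|(p^-1)%:E * (U w)%:E - (U w)%:E * g w|.
  exact: integral_ge0.
have V_ge0 : 0 <= \int[Q]_w (V w)%:E by exact: integral_ge0.
have W_eq0 : \int[P]_w `|(p^-1)%:E * (U w)%:E - (U w)%:E * g w| = 0.
  apply/eqP; rewrite eq_le W_ge0 andbT; apply: le_trans UV; rewrite -W0.
  exact: leeDr.
have V_eq0 : \int[Q]_w (V w)%:E = 0.
  by apply/eqP; rewrite eq_le V_ge0 andbT; move: UV; rewrite -W0 W_eq0 adde0.
have ge0_ae_eq0 (S : probability T R) (h : T -> R) : (forall w, 0 <= h w)%R ->
    S.-integrable setT (EFin \o h) -> \int[S]_w (h w)%:E = 0 ->
    \forall w \ae S, h w = 0%R.
  move=> h0 ih hI.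
  have : ae_eq S setT (EFin \o h) (cst 0).
    apply/(ae_eq_integral_abs S measurableT (measurable_int _ ih)).
    by rewrite -[RHS]hI; apply: eq_integral => w _; rewrite gee0_abs ?lee_fin.
  by apply: filterS => w /(_ I)[].
(* The product of [U] with [1/p - g] vanishes almost surely, and strictness of [g < 1/p] allows
   division by the second factor. *)
have UP0 : \forall w \ae P, U w = 0%R.
  have /(ae_eq_integral_abs P measurableT mW) := W_eq0.
  apply: filterS2 gp => w gp /(_ I) /eqP.
  rewrite muleC -muleBr// mule_eq0 => /orP[/eqP[]//|].
  by rewrite sube_eq// add0e gt_eqF.
have VP0 : \forall w \ae P, V w = 0%R.
  have [N [mN N0 VN]] := ge0_ae_eq0 Q V (funrneg_ge0 _) iVQ V_eq0.
  by exists N; split=> //; move/null_content_dominatesP : PQ'; exact.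
have IU0 : \int[P]_w (U w)%:E = 0.
  rewrite (ae_eq_integral (cst 0)) ?integral0//.
    exact: measurable_int iUP.
  by apply: filterS UP0 => w /= -> _.
(* Once both parts vanish, the price condition reads [c <= 0] and the shortfall condition
   [0 <= c]. *)
have c0 : c = 0%R.
  apply/eqP; rewrite eq_le -!lee_fin; apply/andP; split.
    move: EQ0; rewrite EQE V_eq0 adde0; move: W0.
    by rewrite IU0 mule0 add0e W_eq0 => <-; rewrite adde0.
  by move: ESle; rewrite IU0 mule0.
move: UP0 VP0; apply: filterS2 => w Uw Vw.
have := congr1 (@^~ w) (funrposBneg (cst c \- X)%R).
by rewrite -/U -/V !fctE /= c0 Uw Vw => ?; lra.
Qed.

End no_arbitrage.

(** * The bet against an event *)

Section arbitrage.
Context d (T : measurableType d) (R : realType).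
Variables (A : set T) (k : R).

(* The measurability proof is an argument so that it can be found by inference
   of the measurable function structure on [bet]. *)
Definition bet of measurable A : T -> R := (cst 1%R \- k \o* \1_A)%R.

Hypothesis mA : measurable A.
Local Notation B := (bet mA).

Let mbet : measurable_fun setT B.
Proof. by apply: measurable_funB => //; exact: measurable_funM. Qed.

HB.instance Definition _ := isMeasurableFun.Build _ _ _ _ _ mbet.

Lemma bet_in w : A w -> B w = (1 - k)%R.
Proof. by move=> Aw; rewrite /bet/= indicE mem_set// mul1r. Qed.

Lemma bet_notin w : ~ A w -> B w = 1%R.
Proof. by move=> Aw; rewrite /bet/= indicE memNset// mul0r subr0. Qed.

Implicit Types P Q : probability T R.

Lemma bet_Lfun_infty P : (B : T -> R) \in Lfun P +oo.
Proof.
apply/(Lfun_inftyP (B : {RV P >-> R})); exists (1 + `|k|)%R; apply: nearW => w.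
have [Aw|Aw] := pselect (A w).
  by rewrite /= bet_in// (le_trans (ler_normB _ _))// normr1.
by rewrite /= bet_notin// normr1 lerDl.
Qed.

Lemma expectation_bet P : 'E_P[B] = 1 - k%:E * P A.
Proof.
have iA : (\1_A : T -> R) \in Lfun P 1.
  exact/Lfun1_integrable/integrable_indic.
rewrite expectationB ?expectation_cst ?expectationZl ?expectation_indic//.
  exact: Lfun_cst.
exact: Lfun_scale.
Qed.

(** The quantile is 1 and the shortfall below it is [k] times the indicator of [A], of mean [p];
    hence the value [p / p - 1]. A general [Y] is allowed because the representative of the class of
    the bet is only almost surely equal to it. *)
Lemma ES_bet P (p : R) (Y : {RV P >-> R}) : (0 < p < 1)%R -> (0 < k)%R ->
  P A = (p / k)%:E -> P A <= p%:E -> Y = B %[ae P] -> ES p Y = 0.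
Proof.
move=> p01 k0 PAE PAp Ybet.
have Y1 : (Y : T -> R) \in Lfun P +oo.
  have /(Lfun_inftyP (B : {RV P >-> R}))[M bM] := bet_Lfun_infty P.
  apply/Lfun_inftyP; exists M; apply: filterS2 Ybet bM => w /(_ I) YE bM.
  by rewrite YE.
(* The bet never exceeds 1, so a larger quantile would have all the mass below it. A smaller one
   would put mass more than [p] below 1, yet that mass lies in [A]. *)
have c1 : (- fine (VaR p Y) = 1)%R.
  have dE x : distribution P Y `]-oo, x[ = P (B @^-1` `]-oo, x[).
    by rewrite (ae_eq_distribution _ Ybet).
  apply/eqP; rewrite eq_le; apply/andP; split.
    rewrite leNgt; apply/negP => c1.
    have : p%:E < distribution P Y `]-oo, (- fine (VaR p Y))%R[.
      rewrite dE (_ : _ @^-1` _ = setT) ?probability_setT ?lte_fin//.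
        by case/andP: p01.
      apply/seteqP; split=> w //= _; rewrite in_itv/= (le_lt_trans _ c1)//.
      by rewrite /bet/= gerBl mulr_ge0// ltW.
    by move/(quantile_ltP _ _ p01); rewrite ltxx.
  rewrite leNgt; apply/negP => /(quantile_ltP _ _ p01); apply/negP.
  rewrite -leNgt dE (le_trans _ PAp)// le_measure ?inE//.
    exact: measurable_funPTI.
  move=> w; rewrite /= in_itv/=; apply: contraPP => /bet_notin ->.
  by rewrite ltxx.
rewrite ES_VaR_shortfall//; last exact: Lfun_infty_integrable.
have -> : 'E_P[(cst (- fine (VaR p Y)) \- Y)^\+%R] = k%:E * P A.
  rewrite -expectation_indic// -expectationZl; last first.
    exact/Lfun1_integrable/integrable_indic.
  rewrite unlock; apply: ae_eq_integral => //.
  - apply/measurable_EFinP/measurable_funrpos.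
    exact: measurable_funB.
  - by apply/measurable_EFinP; exact: measurable_funM.
  apply: filterS Ybet => w /(_ I) Yw _; congr EFin.
  rewrite c1 /funrpos /= Yw /bet/= opprB addrC subrK.
  by apply/max_idPl; rewrite mulr_ge0// ltW.
rewrite PAE c1 -!EFinM -EFinB (mulrC k) divfK ?gt_eqF// mulVf ?subrr// gt_eqF//.
by case/andP: p01.
Qed.

End arbitrage.

(** * Arbitrage in the complete market and the size of the density *)

Theorem theorem2p2 (d : measure_display) (T : measurableType d) (R : realType)
    (P Q : probability T R) (PQ : equivalent_measures P Q) (p r t : R)
    (p0 : (0 < p)%R) (p1 : (p < 1)%R) (atomlessP : atomless P) :
  admits_ES_arbitrage (complete_market PQ r t) p <->
  0 < P [set w | (p^-1)%:E <= ('d (charge_of_finite_measure Q) '/d P) w].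
Proof.
have p01 : (0 < p < 1)%R by rewrite p0.
have [PQ' QP] := PQ.
set A := [set w | _].
have mA : measurable A.
  rewrite /A -[X in measurable X]setTI.
  exact: measurable_lee.
split=> [[X [/= XP XES XP0]]|PA].
  move: XP; rewrite /complete_price; case: ifPn => // Xoo EX.
  (* By contraposition: a null [A] makes [X] vanish almost surely, against a positive chance of
     gain. *)
  rewrite lt0e measure_ge0 andbT; apply: contraTneq XP0 => PA0.
  have fp : \forall w \ae P,
      ('d (charge_of_finite_measure Q) '/d P) w < (p^-1)%:E.
    by exists A; split=> // w; rewrite /A/= leNgt => /negP.
  have EQ0 : 'E_Q[L0_RV X] <= 0 by rewrite pmule_rle0// lte_fin expR_gt0 in EX.
  have [N [mN N0 XN]] := ae_eq0_of_density_lt PQ p01 Xoo fp EQ0 XES.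
  rewrite -leNgt -N0 le_measure ?inE//.
    rewrite (_ : [set w | _] = L0_RV X @^-1` `]0%R, +oo[).
      exact: measurable_funPTI.
    by apply/seteqP; split=> w /=; rewrite in_itv/= andbT.
  by move=> w /= Xw; apply: XN => /= X0; rewrite X0 ltxx in Xw.
have PAfin : P A \is a fin_num by exact: fin_num_measure.
(* Integrate over [A] the density, which is at least [1/p] there. *)
have PAp_QA : (p^-1)%:E * P A <= Q A.
  rewrite -[Q A]/(charge_of_finite_measure Q A).
  rewrite (Radon_Nikodym_integral (nu := charge_of_finite_measure Q) QP mA).
  have pV0 : 0 <= (p^-1)%:E by rewrite lee_fin invr_ge0 ltW.
  rewrite -integral_cst//; apply: ge0_le_integral => //.
  exact: measurable_funTS.
have PAp : P A <= p%:E.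
  move: PAp_QA; rewrite lee_pdivrMl// => /le_trans; apply.
  by rewrite -[leRHS]mule1 lee_pmul2l// probability_le1.
have PA_gt0 : (0 < fine (P A))%R by rewrite fine_gt0// PA ltey_eq PAfin.
(* The stake for which the loss on [A] has mean [p], which makes the expected shortfall exactly
   0. *)
pose k := (p / fine (P A))%R.
have k0 : (0 < k)%R by rewrite divr_gt0.
pose X : L0 P := \pi_(L0 P)%qT (bet k mA : {RV P >-> R}).
have Xbet : L0_RV X = bet k mA %[ae P].
  have : (L0_RV X == (bet k mA : {RV P >-> R}) %[mod L0 P])%qT.
    by rewrite /L0_RV reprK.
  by rewrite eqmodE => /asboolP.
have Xoo : Linfty X.
  have /(Lfun_inftyP (bet k mA : {RV P >-> R}))[M bM] := bet_Lfun_infty k mA P.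
  apply/Lfun_inftyP; exists M; apply: filterS2 Xbet bM => w /(_ I) XE bM.
  by rewrite XE.
exists X; split=> /=.
- rewrite /complete_price Xoo pmule_rle0 ?lte_fin ?expR_gt0//.
  have -> : 'E_Q[L0_RV X] = 'E_Q[bet k mA].
    rewrite unlock; apply: ae_eq_integral => //.
    - by apply/measurable_EFinP; exact: measurable_funPT.
    - by apply/measurable_EFinP; exact: measurable_funPT.
    have [N [mN N0 XN]] := Xbet.
    exists N; split=> //; first by move/null_content_dominatesP : QP; exact.
    by apply: subset_trans XN => w; apply: contra_not => XE _; rewrite XE.
  (* A nonpositive price amounts to [1 <= k * Q A], which is [PAp_QA] rearranged. *)
  rewrite expectation_bet sube_le0 /k EFinM -muleA -lee_pdivrMl// mule1.
  by rewrite lee_pdivlMl// fineK// muleC.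
- rewrite (ES_bet p01 k0 _ PAp Xbet)//.
  by rewrite /k invf_div mulrCA divff ?gt_eqF// mulr1 fineK.
- rewrite (_ : [set w | _] = L0_RV X @^-1` `]0%R, +oo[); last first.
    by apply/seteqP; split=> w /=; rewrite in_itv/= andbT.
  have := ae_eq_distribution (measurable_itv `]0%R, +oo[) Xbet.
  rewrite /distribution/pushforward => ->//.
  (* The bet pays 1 off [A], an event of probability at least [1 - p > 0]. *)
  apply: (@lt_le_trans _ _ (P (~` A))).
    rewrite probability_setC// sube_gt0 (le_lt_trans PAp)// lte_fin.
  apply: le_measure; rewrite ?inE//; first exact: measurableC.
    exact: measurable_funPTI.
  by move=> w /bet_notin /=; rewrite in_itv/= andbT => ->.
Qed.
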